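(* $\widehat{\wp}_n$ is a commutative semisimple subalgebra of the peak algebra $\mathcal{P}_n$. Moreover: (a) $\widehat{\wp}_n$ is generated as an algebra by $p_1$ and $\mathring{p}_1$; (b) $\wp_n$ is the subalgebra of $\widehat{\wp}_n$ generated by $p_1$, and it is also semisimple; (c) $\mathring{\wp}_n$ is the two-sided ideal of $\widehat{\wp}_n$ generated by $\mathring{p}_1$; (d) $\dim\widehat{\wp}_n=n$, $\dim\wp_n=\lfloor n/2\rfloor+1$, $\dim\mathring{\wp}_n=\lfloor (n+1)/2\rfloor$.
   Context: For $u\in\mathfrak{S}_n$ (written $u_1\dots u_n$), $\mathrm{Peak}(u)=\{i\in[n-1]:u_{i-1}<u_i>u_{i+1}\}$ with $u_0=0$, and $\mathring{\mathrm{Peak}}(u)=\{i\in\{2,\dots,n-1\}:u_{i-1}<u_i>u_{i+1}\}$. The group algebra $\mathbb{Q}\mathfrak{S}_n$ has product given by composition. $\mathcal{F}_n$ is the set of subsets of $[n-1]$ with no two consecutive integers, $P_F=\sum_{\mathrm{Peak}(u)=F}u$, and the peak algebra is $\mathcal{P}_n=\mathrm{span}\{P_F:F\in\mathcal{F}_n\}$. Define $p_j=\sum_{u:\#\mathrm{Peak}(u)=j}u$ for $j=0,\dots,\lfloor n/2\rfloor$ and $\mathring{p}_j=\sum_{u:\#\mathring{\mathrm{Peak}}(u)=j-1}u$ for $j=1,\dots,\lfloor(n+1)/2\rfloor$. $\wp_n=\mathrm{span}\{p_j\}$, $\mathring{\wp}_n=\mathrm{span}\{\mathring{p}_j\}$,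 $\widehat{\wp}_n=\wp_n+\mathring{\wp}_n$. *)

(* Defs.v *)
From HB Require Import structures.
From mathcomp Require Import all_boot all_order all_algebra all_fingroup.
Set Implicit Arguments. Unset Strict Implicit. Unset Printing Implicit Defensive.
Import Order.TTheory GRing.Theory Num.Theory.
Local Open Scope ring_scope.

(* The group algebra Q S_n, as the Q-vector space of functions S_n -> Q
   (the element sum_u c_u u is the function u |-> c_u). *)
Definition QS (n : nat) := {ffun 'S_n -> rat^o}.

Definition delta n (u : 'S_n) : QS n := [ffun v => (v == u)%:R].

(* product by composition: u . v = u o v, i.e. (u . v)(i) = u(v(i)).
   In mathcomp, (v * u)%g is the permutation  x |-> u (v x),  i.e. u o v. *)
Definition comp n (u v : 'S_n) : 'S_n := (v * u)%g.

Definition gmul n (a b : QS n) : QS n :=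
  [ffun w => \sum_(u : 'S_n) \sum_(v : 'S_n | comp u v == w) a u * b v].

Definition gone n : QS n := delta 1%g.

(* one-line notation: u_k for k = 1..n, with u_0 = 0;
   positions/values are shifted by one from mathcomp's 0-based 'I_n *)
Definition oneline n (u : 'S_n) (k : nat) : nat :=
  nth 0%N (0%N :: [seq (u i).+1 | i <- enum 'I_n]) k.

Definition is_peak n (u : 'S_n) (i : nat) : bool :=
  [&& (0 < i)%N, (i < n)%N, (oneline u i.-1 < oneline u i)%N
    & (oneline u i.+1 < oneline u i)%N].

(* Peak(u), a subset of [n-1] encoded in {set 'I_n} *)
Definition Peak n (u : 'S_n) : {set 'I_n} := [set i : 'I_n | is_peak u i].

Definition iPeak n (u : 'S_n) : {set 'I_n} :=
  [set i : 'I_n | (1 < i)%N && is_peak u i].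

Definition in_Fn n (F : {set 'I_n}) : bool :=
  [forall i in F, (0 < i)%N] && [forall i in F, forall j in F, (i.+1 != j)%N].

Definition P_F n (F : {set 'I_n}) : QS n :=
  \sum_(u : 'S_n | Peak u == F) delta u.

Definition peak_alg n : {vspace QS n} :=
  <<[seq P_F F | F <- enum [pred F : {set 'I_n} | in_Fn F]]>>%VS.

Definition p_ n (j : nat) : QS n := \sum_(u : 'S_n | #|Peak u| == j) delta u.
Definition pc_ n (j : nat) : QS n := \sum_(u : 'S_n | #|iPeak u| == j.-1) delta u.

Definition wp n : {vspace QS n} := <<[seq p_ n j | j <- iota 0 (n./2).+1]>>%VS.
Definition wpc n : {vspace QS n} := <<[seq pc_ n j | j <- iota 1 (n.+1)./2]>>%VS.
Definition wph n : {vspace QS n} := (wp n + wpc n)%VS.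

Definition is_subalg n (V : {vspace QS n}) : Prop :=
  gone n \in V /\ forall a b, a \in V -> b \in V -> gmul a b \in V.

Definition is_comm n (V : {vspace QS n}) : Prop :=
  forall a b, a \in V -> b \in V -> gmul a b = gmul b a.

Definition is_ideal n (V I : {vspace QS n}) : Prop :=
  (I <= V)%VS /\ forall a x, a \in V -> x \in I -> gmul a x \in I /\ gmul x a \in I.

Definition gprod n (s : seq (QS n)) : QS n := foldr (@gmul n) (gone n) s.

Definition nilpotent_ideal n (I : {vspace QS n}) : Prop :=
  exists k : nat, (0 < k)%N /\
    forall s : seq (QS n), size s = k -> all (fun x => x \in I) s -> gprod s = 0.

(* a (finite-dimensional) algebra is semisimple iff it has no nonzero
   nilpotent two-sided ideal (i.e. its Jacobson radical is zero) *)
Definition is_semisimple n (V : {vspace QS n}) : Prop :=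
  is_subalg V /\
  forall I : {vspace QS n}, is_ideal V I -> nilpotent_ideal I -> I = 0%VS.

Definition subalg_generated_by n (V : {vspace QS n}) (S : seq (QS n)) : Prop :=
  [/\ is_subalg V, {subset S <= V} &
      forall W : {vspace QS n}, is_subalg W -> {subset S <= W} -> (V <= W)%VS].

Definition ideal_generated_by n (V I : {vspace QS n}) (x : QS n) : Prop :=
  [/\ is_ideal V I, x \in I &
      forall J : {vspace QS n}, is_ideal V J -> x \in J -> (I <= J)%VS].

(* Main.v *)
(** For a >= 0 let M_a be the sum of the permutations w counted with the number of maps
    f : [n] -> [a] such that w lists [n] by decreasing values of f, ties being broken upwards
    where f is even and downwards where f is odd (a shuffle of a packets, every other one
    reversed).  Composing two such shuffles gives M_a M_b = M_(ab).

    Scanning the descents of w from the right shows that the coefficient of w in M_(2k+1) is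
    sum_m q_m C(k,m) with q = (1+2X)^(n-2j) (4X(1+X))^j and j = #Peak(w), while in M_(2k) it is
    given by q = 2X (1+2X)^(n-1-2i) (4X(1+X))^i with i the number of interior peaks.  Hence wp_n
    is the span of the odd M_a and wpc_n the span of the even ones, and M_a = sum_j a^j e_j where
    the e_j depend only on the parity of a.  Inverting a Vandermonde matrix at the powers of 3
    turns M_a M_b = M_(ab) into e_i e'_j = delta_ij e''_j (e'' odd only if both e and e' are), so
    both spaces are spanned by orthogonal idempotents, each a combination of the M_(3^k), resp.
    M_(2 3^k).  Finally M_3 and p_1 generate the same unital algebra, and M_2 is a multiple of
    the first interior sum. *)

Require Import Defs.
From HB Require Import structures.
From mathcomp Require Import all_boot all_order all_algebra all_fingroup.
From mathcomp Require Import zify ring.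
Set Implicit Arguments. Unset Strict Implicit. Unset Printing Implicit Defensive.
Import Order.TTheory GRing.Theory Num.Theory.
Local Open Scope ring_scope.

(** * Bilinearity and unit of the group algebra product *)

Lemma gmulE n (a b : QS n) w : gmul a b w = \sum_u a u * b (w * u^-1)%g.
Proof.
rewrite ffunE; apply: eq_bigr => u _; rewrite (big_pred1 (w * u^-1)%g) //= => v.
by rewrite /comp -(inj_eq (mulIg u^-1)%g) mulgK.
Qed.

Lemma addQSE n (a b : QS n) w : (a + b) w = a w + b w. Proof. by rewrite ffunE. Qed.

Lemma scaleQSE n c (a : QS n) w : (c *: a) w = c * a w. Proof. by rewrite ffunE. Qed.

Lemma gmul_is_linear n (a : QS n) : linear (gmul a).
Proof.
move=> c b b'; apply/ffunP => w; rewrite addQSE scaleQSE !gmulE mulr_sumr -big_split /=.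
by apply: eq_bigr => u _; rewrite addQSE scaleQSE mulrDr mulrCA.
Qed.

HB.instance Definition _ n (a : QS n) :=
  GRing.isLinear.Build rat (QS n) (QS n) *:%R (gmul a) (@gmul_is_linear n a).

(** The product with its arguments swapped, named so that linearity in the left factor can also be
    registered as an instance. *)
Definition gmulr n (b a : QS n) := gmul a b.

Lemma gmulr_is_linear n (b : QS n) : linear (gmulr b).
Proof.
move=> c a a'; apply/ffunP => w.
rewrite /gmulr addQSE scaleQSE !gmulE mulr_sumr -big_split /=.
by apply: eq_bigr => u _; rewrite addQSE scaleQSE mulrDl mulrA.
Qed.

HB.instance Definition _ n (b : QS n) :=
  GRing.isLinear.Build rat (QS n) (QS n) *:%R (gmulr b) (@gmulr_is_linear n b).

Lemma gmul_sumr n I r (P : pred I) (a : QS n) (c : I -> rat) (F : I -> QS n) :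
  gmul a (\sum_(i <- r | P i) c i *: F i) = \sum_(i <- r | P i) c i *: gmul a (F i).
Proof. by rewrite linear_sum; apply: eq_bigr => i _; rewrite linearZ. Qed.

Lemma gmul_suml n I r (P : pred I) (b : QS n) (c : I -> rat) (F : I -> QS n) :
  gmul (\sum_(i <- r | P i) c i *: F i) b = \sum_(i <- r | P i) c i *: gmul (F i) b.
Proof.
rewrite -/(gmulr b _) linear_sum; apply: eq_bigr => i _.
by rewrite linearZ.
Qed.

Lemma gmul1 n (a : QS n) : gmul a (gone n) = a.
Proof.
apply/ffunP => w; rewrite gmulE (bigD1 w) //= mulgV !ffunE eqxx mulr1.
rewrite big1 ?addr0 // => u nuw; rewrite ffunE; case: eqP => [E|_]; rewrite ?mulr0 //.
by case/eqP: nuw; apply/(mulIg u^-1)%g; rewrite mulgV E.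
Qed.

(** * Arithmetic of the alternating lexicographic code *)

(* The rank of (d, x) in the lexicographic order on N * [0, m) in which the fibres over odd d
   are reversed. *)
Definition twist (m d x : nat) := (d * m + if odd d then m.-1 - x else x)%N.

Lemma twist_bound m d x : (x < m -> d * m <= twist m d x < d.+1 * m)%N.
Proof. by rewrite /twist mulSn; case: odd; lia. Qed.

Lemma twist_lt m d d' x x' : (x < m)%N -> (x' < m)%N ->
  (twist m d x < twist m d' x')%N =
  (d < d')%N || (d == d') && (if odd d then (x' < x)%N else (x < x')%N).
Proof.
move=> hx hx'; have := twist_bound d hx; have := twist_bound d' hx'.
case: (ltngtP d d') => [h|h|->] /=; last by rewrite /twist; case: odd; lia.
- by have := leq_mul2r m d.+1 d'; rewrite h orbT; lia.
- by have := leq_mul2r m d'.+1 d; rewrite h orbT; lia.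
Qed.

Lemma twist_inj m d d' x x' : (x < m)%N -> (x' < m)%N ->
  twist m d x = twist m d' x' -> d = d' /\ x = x'.
Proof.
move=> hx hx' E; have := twist_lt d d' hx hx'; have := twist_lt d' d hx' hx.
rewrite E ltnn eq_sym; case: (ltngtP d d') => [h|h|<-] //=.
by case: odd; lia.
Qed.

(** For odd [d] the code is d m + m - 1 - x, which has the parity of x + 1; for even [d] the term d
    m is even. The parity is therefore independent of [m]. *)
Lemma odd_twist m d x : (x < m)%N -> odd (twist m d x) = odd d (+) odd x.
Proof.
case: m => // m hx; rewrite /twist oddD oddM /=; case: (odd d); last by [].
by rewrite oddB //=; do 2!case: odd.
Qed.

(* Alternating the signs of the letters makes the reversed and sign-flipped copies of an
   alphabet fit together into an alternating alphabet again. *)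
Lemma twistA m a d y x : (x < m)%N -> (y < a)%N ->
  twist m (twist a d y) x = twist (a * m) d (twist m y x).
Proof.
move=> hx hy; rewrite {1}/twist odd_twist // /twist; case: (odd d) => /=; last first.
  by case: (odd y); nia.
by case: (odd y) => /=; nia.
Qed.

(** * Permutations that list the letters by decreasing key *)

Definition sorts n (K : 'I_n -> nat) (w : 'S_n) :=
  [forall i : 'I_n, forall j : 'I_n, (i < j) ==> (K (w j) < K (w i))]%N.

Lemma sortsP n (K : 'I_n -> nat) (w : 'S_n) :
  reflect (forall i j : 'I_n, (i < j)%N = (K (w j) < K (w i))%N) (sorts K w).
Proof.
apply: (iffP 'forall_forallP) => [h i j|h i j]; last by rewrite h implybb.
have h1 := implyP (h i j); have h2 := implyP (h j i).
case: (ltngtP i j) => [/h1|/h2|/val_inj->]; [by move-> | lia | by rewrite ltnn].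
Qed.

Lemma sorts_exists n (K : 'I_n -> nat) : injective K -> exists w, sorts K w.
Proof.
(* [r x] counts the letters with a larger key. It is the position of [x] in the sorted list, so the
   sorting permutation is the inverse of [r]. *)
move=> injK; pose r x := #|[set y | K x < K y]%N|.
have r_lt x y : (K x < K y)%N -> (r y < r x)%N.
  move=> h; apply: proper_card; apply/properP; split.
    by apply/subsetP => z; rewrite !inE; apply: ltn_trans.
  by exists y; rewrite !inE // ltnn.
have rn x : (r x < n)%N.
  rewrite -[X in (_ < X)%N](card_ord n) -cardsT; apply: proper_card.
  by apply/properP; split; [exact: subsetT | exists x; rewrite !inE // ltnn].
have injr : injective (fun x => Ordinal (rn x)).
  move=> x y [] E; apply: injK; case: (ltngtP (K x) (K y)) => // /r_lt; rewrite E ltnn //.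
exists (perm injr)^-1%g; apply/sortsP => i j.
move: ((perm injr)^-1%g i) ((perm injr)^-1%g j) (permKV (perm injr) i) (permKV (perm injr) j).
move=> x y <- <-; rewrite !permE /=.
by case: (ltngtP (K y) (K x)) => [/r_lt//|/r_lt|/injK->]; [lia | rewrite ltnn].
Qed.

(** The inverse of a sorting permutation is forced: it sends [x] to the number of letters with a
    larger key. *)
Lemma sorts_unique n (K : 'I_n -> nat) w w' : sorts K w -> sorts K w' -> w = w'.
Proof.
have H v : sorts K v -> forall x, (v^-1)%g x = #|[set y | K x < K y]%N| :> nat.
  move=> /sortsP h x; rewrite -sum1dep_card (reindex_inj (@perm_inj _ v)) /=.
  rewrite -[LHS]card_ord -sum1_card (big_ord_widen _ (fun=> 1%N) (ltnW (ltn_ord _))).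
  by apply: eq_bigl => i; rewrite h permKV.
move=> hw hw'; apply: invg_inj; apply/permP => x; apply: val_inj.
by rewrite /= (H _ hw) (H _ hw').
Qed.

Lemma sum_sorts n (K : 'I_n -> nat) : injective K ->
  \sum_w (sorts K w)%:R = 1 :> rat.
Proof.
move=> /sorts_exists [w hw]; rewrite (bigD1 w) //= hw big1 ?addr0 // => v nvw.
by case E: (sorts K v) => //; case/eqP: nvw; apply: sorts_unique E hw.
Qed.

(** * Shuffles and their multiplication rule *)

(** Letters are listed by decreasing key, so [rev_ord] makes ties at even values break upwards;
    [twist] reverses them at odd values. *)
Definition key n a (f : {ffun 'I_n -> 'I_a}) (x : 'I_n) := twist n (f x) (rev_ord x).

Lemma key_inj n a (f : {ffun 'I_n -> 'I_a}) : injective (key f).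
Proof.
move=> x y /twist_inj [] // _ E.
by apply/rev_ord_inj/val_inj.
Qed.

Definition shuffle n a : QS n :=
  [ffun w => \sum_(f : {ffun 'I_n -> 'I_a}) (sorts (key f) w)%:R].

(** Since [u] sorts by [key f], the positions [u^-1 x] are ordered oppositely to the keys of [f].
    Sorting positions by g o u is thus sorting letters by g and then by [key f], and [twistA]
    regroups this as one key for the combined value. *)
Lemma sorts_comp n a (f : {ffun 'I_n -> 'I_a}) (g : 'I_n -> nat) (u w : 'S_n) :
  sorts (key f) u ->
  sorts (fun i => twist n (g (u i)) (rev_ord i)) (w * u^-1)%g =
  sorts (fun x => twist n (twist a (g x) (f x)) (rev_ord x)) w.
Proof.
move=> /sortsP hu; apply: eq_forallb => i; apply: eq_forallb => j; congr (_ ==> _).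
rewrite !permM !permKV !twistA ?ltn_ord //.
have kb x : (twist n (f x) (rev_ord x) < a * n)%N.
  have /andP [_ h] := @twist_bound n (f x) (rev_ord x) (ltn_ord _).
  apply: leq_trans h _; rewrite leq_mul2r ltn_ord orbT //.
have hk x y : (key f x < key f y)%N = ((u^-1)%g y < (u^-1)%g x)%N by rewrite hu !permKV.
rewrite [LHS]twist_lt ?ltn_ord // [RHS]twist_lt ?kb // !hk /=.
have := ltn_ord ((u^-1)%g (w i)); have := ltn_ord ((u^-1)%g (w j)).
by move=> ? ?; congr (_ || _ && _); case: odd; lia.
Qed.

Lemma shuffleM n a b : gmul (shuffle n a) (shuffle n b) = shuffle n (a * b).
Proof.
apply/ffunP => w; rewrite gmulE [RHS]ffunE.
(* Pairs of maps to [a] and [b] correspond to maps to [ab] through this alternating mixed-radix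
   code, with the first map as the low digit. *)
pose hf (p : {ffun 'I_n -> 'I_a} * {ffun 'I_n -> 'I_b}) (x : 'I_n) := twist a (p.2 x) (p.1 x).
have hb p x : (hf p x < a * b)%N.
  have /andP [_ h] := @twist_bound a (p.2 x) (p.1 x) (ltn_ord _).
  by apply: leq_trans h _; rewrite mulnC leq_mul2l ltn_ord orbT.
pose H p : {ffun 'I_n -> 'I_(a * b)} := [ffun x => Ordinal (hb p x)].
have H_bij : bijective H.
  apply: inj_card_bij; last by rewrite card_prod !card_ffun !card_ord expnMn.
  move=> [f g] [f' g'] /ffunP E; congr (_, _); apply/ffunP => x;
   move: (E x); rewrite !ffunE => /(congr1 val) /= /twist_inj [] // E1 E2;
   exact: val_inj.
rewrite (reindex H) /=; last exact: onW_bij.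
transitivity (\sum_u \sum_(f : {ffun 'I_n -> 'I_a}) \sum_(g : {ffun 'I_n -> 'I_b})
   (sorts (key f) u)%:R * (sorts (key (H (f, g))) w)%:R : rat).
  apply: eq_bigr => u _; rewrite !ffunE mulr_suml; apply: eq_bigr => f _.
  rewrite -mulr_sumr; case hu : (sorts _ u); rewrite ?mul0r //; congr (_ * _).
  (* The second shuffle labels positions of [u]; reindexing by g o u labels letters instead. *)
  pose c (g : {ffun 'I_n -> 'I_b}) : {ffun 'I_n -> 'I_b} := [ffun i => g (u i)].
  rewrite (reindex c) /=; last first.
    exists (fun g : {ffun 'I_n -> 'I_b} => [ffun i => g ((u^-1)%g i)]) => g _;
     by apply/ffunP => x; rewrite !ffunE ?permK ?permKV.
  apply: eq_bigr => g _; congr (_%:R : rat); congr nat_of_bool.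
  have := @sorts_comp n a f (fun x => g x) u w hu.
  rewrite /sorts; set A := LHS; set B := RHS => E.
  transitivity A; [|rewrite E]; apply: eq_forallb => i; apply: eq_forallb => j;
    by rewrite /key !ffunE.
transitivity (\sum_(f : {ffun 'I_n -> 'I_a}) \sum_(g : {ffun 'I_n -> 'I_b})
   (sorts (key (H (f, g))) w)%:R : rat); last first.
  by rewrite pair_bigA; apply: eq_bigr => -[].
(* For fixed f and g only the first factor still depends on [u], and exactly one [u] sorts by
   [key f]. *)
rewrite exchange_big; apply: eq_bigr => f _; rewrite exchange_big; apply: eq_bigr => g _.
by rewrite -mulr_suml sum_sorts ?mul1r //; apply: key_inj.
Qed.

Lemma shuffle1 n : shuffle n 1 = gone n.
Proof.
apply/ffunP => w; rewrite !ffunE (big_pred1 [ffun=> ord0]) => [|f]; last first.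
  by apply/esym/eqP/ffunP => x; rewrite !ord1.
congr (nat_of_bool _)%:R; set K := key _.
have h1 : sorts K 1%g.
  apply/sortsP => i j; rewrite !perm1 /K /key !ffunE /twist /= mul0n.
  by have := ltn_ord i; have := ltn_ord j; lia.
by apply/idP/eqP => [h|-> //]; apply: sorts_unique h h1.
Qed.

(** * Coefficients of shuffles as chain counts along the descent word *)

Definition step (b : bool) (d e : nat) : bool := ((e < d) || ((e == d) && (odd d == b)))%N.

Fixpoint chain (s : seq bool) (d : nat) (t : seq nat) : bool :=
  if s is b :: s' then step b d (head 0%N t) && chain s' (head 0%N t) (behead t)
  else true.

Fixpoint nchain_from (s : seq bool) (d : nat) : nat :=
  if s is b :: s' then
    (\sum_(e < d) nchain_from s' e + if odd d == b then nchain_from s' d else 0)%N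
  else 1%N.

(* Counts the weakly decreasing sequences with values below a in which the i-th tie occurs at an
   odd value exactly when the i-th entry of s is a descent. *)
Definition nchain s a := (\sum_(d < a) nchain_from s d)%N.

Lemma chainP s d t :
  reflect (forall i, (i < size s)%N ->
             step (nth false s i) (nth 0%N (d :: t) i) (nth 0%N t i))
          (chain s d t).
Proof.
elim: s d t => [|b s IH] d t /=; first by constructor.
have nt i : nth 0%N (head 0%N t :: behead t) i = nth 0%N t i.
  by case: t i => [|e t] [|i] //=; rewrite nth_nil.
apply: (iffP andP) => [[h1 /IH h2] [_|i /h2]|h].
- by rewrite /= nth0.
- by rewrite nt nth_behead.
split; first by have := h 0%N isT; rewrite /= nth0.
by apply/IH => i hi; rewrite nt nth_behead; apply: (h i.+1).
Qed.

Lemma sum_tuple_cons (T : finType) m (P : m.+1.-tuple T -> nat) :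
  (\sum_t P t = \sum_x \sum_(t : m.-tuple T) P [tuple of x :: t])%N.
Proof.
rewrite pair_bigA /= (reindex (fun p : T * m.-tuple T => [tuple of p.1 :: p.2])) //=.
exists (fun t : m.+1.-tuple T => (thead t, [tuple of behead t])) => [[x t] _|t _] /=.
  by congr (_, _); apply: val_inj.
by rewrite -tuple_eta.
Qed.

(** Values never rise along a chain, so [d < a] leaves room for all of them in ['I_a] and the count
    does not depend on [a]. *)
Lemma sum_chain a s d : (d < a)%N ->
  (\sum_(t : (size s).-tuple 'I_a) chain s d (map val t) = nchain_from s d)%N.
Proof.
elim: s d => [|b s IH] d hd /=.
  by rewrite sum_nat_const card_tuple expn0.
rewrite sum_tuple_cons /=.
transitivity (\sum_(e < a | step b d e) nchain_from s e)%N.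
  rewrite [RHS]big_mkcond; apply: eq_bigr => e _; case: ifP => he; last by rewrite big1.
  by rewrite -(IH e) ?ltn_ord.
rewrite -(big_mkord (step b d) (nchain_from s)) (big_cat_nat (leq0n d) (ltnW hd)) //=.
congr (_ + _)%N.
  by rewrite big_mkord; apply: eq_bigl => i; rewrite /step ltn_ord.
rewrite big_ltn_cond // /step ltnn eqxx /= big_nat_cond big1; first by case: ifP; rewrite ?addn0.
by move=> e; lia.
Qed.

Definition descent m (w : 'S_m.+1) (i : nat) : bool := (w (inord i.+1) < w (inord i))%N.

Definition descent_word m (w : 'S_m.+1) : seq bool := [seq descent w i | i <- iota 0 m].

Lemma sorts_adj m (K : 'I_m.+1 -> nat) (w : 'S_m.+1) :
  reflect (forall i, (i < m)%N -> (K (w (inord i.+1)) < K (w (inord i)))%N) (sorts K w).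
Proof.
apply: (iffP 'forall_forallP) => [h i hi|h i j].
  by apply: (implyP (h _ _)); rewrite !inordK //; lia.
apply/implyP => hij.
have H k : (i + k.+1 < m.+1)%N -> (K (w (inord (i + k.+1))) < K (w i))%N.
  elim: k => [|k IH] hk; first by rewrite -{2}(inord_val i) addn1; apply: h; lia.
  by apply: ltn_trans (IH _); [rewrite addnS; apply: h; lia | lia].
have := H (j - i.+1)%N; have -> : (i + (j - i.+1).+1 = j)%N by lia.
by rewrite inord_val ltn_ord; apply.
Qed.

(** Read along [w], a map f becomes a sequence of values. Adjacent keys decrease exactly when the
    value drops, or when it stays and is odd at a descent, even at an ascent. *)
Lemma shuffleE m a (w : 'S_m.+1) : shuffle m.+1 a w = (nchain (descent_word w) a)%:R.
Proof.
rewrite ffunE -natr_sum; congr (_%:R).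
have sz : size (descent_word w) = m by rewrite size_map size_iota.
transitivity (\sum_(d < a) \sum_(t : m.-tuple 'I_a) chain (descent_word w) d (map val t))%N; last first.
  by apply: eq_bigr => d _; have := sum_chain (descent_word w) (ltn_ord d); rewrite sz.
transitivity (\sum_(t : m.+1.-tuple 'I_a) chain (descent_word w) (thead t) (behead (map val t)))%N;
  last by rewrite sum_tuple_cons.
rewrite (reindex (fun f : {ffun 'I_m.+1 -> 'I_a} => [tuple f (w i) | i < m.+1])) /=; last first.
  exists (fun t : m.+1.-tuple 'I_a => [ffun x => tnth t ((w^-1)%g x)]) => [f _|t _].
    by apply/ffunP => x; rewrite ffunE tnth_mktuple permKV.
  by apply: eq_from_tnth => i; rewrite tnth_mktuple ffunE permK.
have et (t : m.+1.-tuple 'I_a) : map val t = nat_of_ord (thead t) :: behead (map val t).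
  by case/tupleP: t => x t; rewrite theadE.
apply: eq_bigr => f _; congr nat_of_bool.
set t := [tuple _ | _ < _].
have nt i : (i < m.+1)%N -> nth 0%N (map val t) i = f (w (inord i)).
  move=> hi; rewrite (nth_map (f (w (inord i)))) ?size_tuple //.
  by rewrite -[i in nth _ _ i](inordK hi) -tnth_nth tnth_mktuple.
have E i : (i < m)%N -> (key f (w (inord i.+1)) < key f (w (inord i)))%N =
    step (nth false (descent_word w) i) (f (w (inord i))) (f (w (inord i.+1))).
  move=> hi; rewrite (nth_map 0%N) ?size_iota // nth_iota // add0n.
  rewrite /key twist_lt ?ltn_ord // /step /descent.
  have : w (inord i) != w (inord i.+1) :> nat.
    by rewrite (inj_eq val_inj) (inj_eq perm_inj) -(inj_eq val_inj) /= !inordK //; lia.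
  have := ltn_ord (w (inord i)); have := ltn_ord (w (inord i.+1)) => /=.
  by case: (ltngtP (f (w (inord i)))) => //= ->; case: odd; lia.
apply/sorts_adj/chainP; rewrite sz => h i hi; have := h i hi;
  by rewrite E // -et nth_behead !nt ?ltnS // ltnW.
Qed.

(** * Peak numbers read off the descent word *)

(* [b] tells whether the step preceding the word is a descent: [false] models u_0 = 0, and [true]
   forbids a peak in the first position. *)
Fixpoint peaks (b : bool) (s : seq bool) : nat :=
  if s is d :: s' then ((~~ b && d) + peaks d s')%N else 0%N.

Lemma peaks_iota (D : nat -> bool) k m :
  peaks (D k) [seq D i | i <- iota k.+1 m] = (\sum_(k.+1 <= i < k.+1 + m) (~~ D i.-1 && D i))%N.
Proof.
elim: m k => [|m IH] k /=; first by rewrite addn0 big_geq.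
by rewrite IH addSnnS [RHS]big_ltn //; lia.
Qed.

Lemma onelineS m (w : 'S_m.+1) i : (i <= m)%N -> oneline w i.+1 = (w (inord i)).+1.
Proof.
move=> hi; rewrite /oneline /= (nth_map ord0) ?size_enum_ord //.
by congr (w _).+1; apply: val_inj; rewrite /= nth_enum_ord ?inordK.
Qed.

(** Positions of peaks count from 1 and steps of [descent] from 0, so position i lies between steps
    i - 2 and i - 1. At i = 1 the preceding step starts at u_0 = 0 and is an ascent, whence the
    guard. *)
Lemma is_peakE m (w : 'S_m.+1) i : (0 < i <= m)%N ->
  is_peak w i = ~~ ((0 < i.-1)%N && descent w i.-2) && descent w i.-1.
Proof.
case: i => // i hi.
have -> : is_peak w i.+1 = (oneline w i < oneline w i.+1)%N && (oneline w i.+2 < oneline w i.+1)%N.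
  by rewrite /is_peak [(i.+1 < m.+1)%N]ltnS; move: hi => /= ->.
rewrite (@onelineS _ _ i.+1) // (@onelineS _ _ i) ?(ltnW hi) //.
rewrite [in X in _ && X]ltnS -/(descent w i); congr (_ && _).
case: i hi => [//|i] hi; rewrite onelineS; last by lia.
rewrite ltnS /descent -leqNgt /= [RHS]leq_eqVlt orb_idl // => /eqP/val_inj/perm_inj /(congr1 val).
by rewrite /= !inordK; lia.
Qed.

Lemma card_Peak m (w : 'S_m.+1) : #|Peak w| = peaks false (descent_word w).
Proof.
(* Shifted by one, with [D 0] the ascent from u_0 = 0. *)
pose D i := (0 < i)%N && descent w i.-1.
have -> : descent_word w = [seq D i | i <- iota 1 m].
  by rewrite /descent_word (iotaDl 1 0) -map_comp; apply: eq_map.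
rewrite (@peaks_iota D 0) -sum1_card big_mkcond add1n /=.
rewrite (eq_bigr (fun i : 'I_m.+1 => nat_of_bool (is_peak w i))); last first.
  by move=> i _; rewrite inE; case: ifP.
rewrite -(big_mkord xpredT (fun i => nat_of_bool (is_peak w i))) big_ltn // add0n.
by apply: eq_big_nat => i hi; rewrite is_peakE // /D; case: i hi.
Qed.

Lemma card_iPeak m (w : 'S_m.+1) : #|iPeak w| = peaks true (descent_word w).
Proof.
pose D i := (0 < i)%N && descent w i.-1.
have -> : descent_word w = [seq D i | i <- iota 1 m].
  by rewrite /descent_word (iotaDl 1 0) -map_comp; apply: eq_map.
rewrite -sum1_card big_mkcond.
rewrite (eq_bigr (fun i : 'I_m.+1 => nat_of_bool ((1 < i)%N && is_peak w i))); last first.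
  by move=> i _; rewrite inE; case: ifP.
rewrite -(big_mkord xpredT (fun i => nat_of_bool ((1 < i)%N && is_peak w i))) big_ltn //= add0n.
case: m w @D => [|m] w D; first by rewrite big_geq.
rewrite big_ltn //= (@peaks_iota D 1).
apply: eq_big_nat => -[|[|i]] // hi.
by rewrite is_peakE // /D.
Qed.

(** * Chain counts in the binomial basis *)

(** The linear map sending X^m to C(k,m). By Pascal's rule, multiplication by X becomes summation
    over the integers below k. *)
Definition binom_sum (q : {poly rat}) (k : nat) : rat := \sum_(m < k.+1) q`_m * 'C(k, m)%:R.

Lemma binom_sum_widen q k N : (k < N)%N -> binom_sum q k = \sum_(m < N) q`_m * 'C(k, m)%:R.
Proof.
move=> hk; rewrite /binom_sum (big_ord_widen N (fun m => q`_m * 'C(k, m)%:R)) // big_mkcond.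
by apply: eq_bigr => m _; case: ltnP => // h; rewrite bin_small ?mulr0.
Qed.

Lemma binom_sumD q r k : binom_sum (q + r) k = binom_sum q k + binom_sum r k.
Proof. by rewrite -big_split; apply: eq_bigr => m _; rewrite coefD mulrDl. Qed.

Lemma binom_sumMn q i k : binom_sum (q *+ i) k = binom_sum q k *+ i.
Proof. by rewrite -sumrMnl; apply: eq_bigr => m _; rewrite coefMn mulrnAl. Qed.

Lemma binom_sumX0 q : binom_sum ('X * q) 0 = 0.
Proof. by rewrite /binom_sum big_ord1 coefXM mul0r. Qed.

Lemma binom_sumXS q k : binom_sum ('X * q) k.+1 = binom_sum ('X * q) k + binom_sum q k.
Proof.
rewrite (binom_sum_widen ('X * q) (leqnSn k.+1)) /binom_sum !(big_ord_recl k.+1) !coefXM !mul0r !add0r.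
by rewrite -big_split; apply: eq_bigr => m _; rewrite !coefXM /= binS natrD mulrDr.
Qed.

Lemma binom_sum_small j q k : (k < j)%N -> binom_sum ('X^j * q) k = 0.
Proof.
move=> hk; apply: big1 => m _; rewrite coefXnM (leq_trans (ltn_ord m)) ?mul0r //.
Qed.

Lemma binom_sum_diag j q : binom_sum ('X^j * q) j = q.[0].
Proof.
rewrite /binom_sum big_ord_recr /= big1 ?add0r => [|m _].
  by rewrite coefXnM ltnn subnn binn mulr1 horner_coef0.
by rewrite coefXnM ltn_ord mul0r.
Qed.

Lemma nchainS s a : nchain s a.+1 = (nchain s a + nchain_from s a)%N.
Proof. by rewrite /nchain big_ord_recr. Qed.

Lemma nchain0 s : nchain s 0 = 0%N.
Proof. by rewrite /nchain big_ord0. Qed.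

Lemma nchain_consS b s a : nchain (b :: s) a.+1 =
  (nchain (b :: s) a + nchain s (if odd a == b then a.+1 else a))%N.
Proof. by rewrite nchainS /=; case: eqP => _; rewrite ?nchainS ?addn0. Qed.

(** A leading ascent allows ties at even values only, so the first values 2k and 2k+1 each
    contribute [nchain s] at 2k+1. Summation gives 2Xq at even arguments, and one more first value
    adds q. *)
Lemma nchain_asc s q : (forall k, (nchain s k.*2.+1)%:R = binom_sum q k) ->
  (forall k, (nchain (false :: s) k.*2)%:R = binom_sum ('X * q *+ 2) k) /\
  (forall k, (nchain (false :: s) k.*2.+1)%:R = binom_sum (('X *+ 2 + 1) * q) k).
Proof.
move=> hq; have hE k : (nchain (false :: s) k.*2)%:R = binom_sum ('X * q *+ 2) k.
  elim: k => [|k IH]; first by rewrite nchain0 binom_sumMn binom_sumX0 mul0rn.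
  rewrite doubleS !nchain_consS /= odd_double /= !natrD IH hq !binom_sumMn binom_sumXS.
  by ring.
by split=> // k; rewrite nchain_consS odd_double /= natrD hE hq mulrDl mul1r mulrnAl !binom_sumD.
Qed.

(** A leading descent allows ties at odd values only, so the first values 2k and 2k+1 contribute
    [nchain s] at 2k and at 2k+2. As [nchain s 0] vanishes, this sums to (2X+1)q, and one more first
    value adds q. *)
Lemma nchain_desc s q : (forall k, (nchain s k.*2)%:R = binom_sum q k) ->
  (forall k, (nchain (true :: s) k.*2)%:R = binom_sum (('X *+ 2 + 1) * q) k) /\
  (forall k, (nchain (true :: s) k.*2.+1)%:R = binom_sum ((1 + 'X) * q *+ 2) k).
Proof.
move=> hq; have hE k : (nchain (true :: s) k.*2)%:R = binom_sum (('X *+ 2 + 1) * q) k.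
  rewrite mulrDl mul1r mulrnAl binom_sumD binom_sumMn.
  elim: k => [|k IH]; first by rewrite -hq !nchain0 binom_sumX0 mul0rn addr0.
  rewrite doubleS !nchain_consS /= odd_double /= !natrD IH -doubleS !hq binom_sumXS.
  by ring.
split=> // k; rewrite nchain_consS odd_double /= natrD hE hq.
by rewrite binom_sumMn !mulrDl !mul1r !binom_sumD; ring.
Qed.

(** * Expansion of shuffles by peak numbers *)

Definition peak_poly n j : {poly rat} :=
  ('X *+ 2 + 1) ^+ (n - j.*2) * ('X * (1 + 'X) *+ 4) ^+ j.

Definition ipeak_poly n j : {poly rat} :=
  ('X *+ 2) * (('X *+ 2 + 1) ^+ (n.-1 - j.*2) * ('X * (1 + 'X) *+ 4) ^+ j).

(** Induction on the first letter. Before an ascent both statistics become [peaks false s]; before a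
    descent they become [1 + peaks true s] and [peaks true s], in step with the two recursions. The
    bounds keep the truncated subtractions in the exponents exact. *)
Lemma nchain_peaks s :
  [/\ ((peaks false s).*2 <= (size s).+1)%N, ((peaks true s).*2 <= size s)%N,
     forall k, (nchain s k.*2.+1)%:R = binom_sum (peak_poly (size s).+1 (peaks false s)) k &
     forall k, (nchain s k.*2)%:R = binom_sum (ipeak_poly (size s).+1 (peaks true s)) k].
Proof.
elim: s => [|[] s [hj hi hO hE]].
- have h a : nchain [::] a = a by rewrite /nchain /= sum1_card card_ord.
  have X k : binom_sum 'X k = k%:R.
    rewrite -['X]mulr1; elim: k => [|k IH]; first by rewrite binom_sumX0.
    rewrite binom_sumXS IH /binom_sum big_ord_recl big1 ?coef1 ?bin0 ?mulr1 ?addr0 ?natr1 //.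
    by move=> m _; rewrite coef1 mul0r.
  have O k : binom_sum 1 k = 1.
    by rewrite /binom_sum big_ord_recl big1 ?coef1 ?bin0 ?mulr1 ?addr0 // => m _; rewrite coef1 mul0r.
  split=> // k; rewrite h /peak_poly /ipeak_poly /= ?expr0 ?expr1 ?mulr1.
    by rewrite binom_sumD binom_sumMn X O -natr1 -muln2 natrM mulr_natr.
  by rewrite binom_sumMn X -muln2 natrM mulr_natr.
- have [h1 h2] := nchain_desc hE; rewrite /= add0n add1n; split=> // [|k|k]; first lia.
  + by rewrite h2 /peak_poly /ipeak_poly doubleS subSS exprS /=; congr binom_sum; ring.
  + by rewrite h1 /ipeak_poly /= (subSn hi) exprS; congr binom_sum; ring.
have [h1 h2] := nchain_asc hO; rewrite /= add0n; split=> // [|k|k]; first lia.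
- by rewrite h2 /peak_poly (subSn hj) exprS; congr binom_sum; ring.
- by rewrite h1 /peak_poly /ipeak_poly /=; congr binom_sum; ring.
Qed.

Lemma Peak_bound n (w : 'S_n) : (#|Peak w| <= n./2)%N.
Proof.
case: n w => [|m] w; first by rewrite -[X in (_ <= X)%N](card_ord 0) max_card.
rewrite card_Peak; have [+ _ _ _] := nchain_peaks (descent_word w).
by rewrite size_map size_iota; lia.
Qed.

Lemma iPeak_bound n (w : 'S_n) : (0 < n)%N -> (#|iPeak w| < n.+1./2)%N.
Proof.
case: n w => [//|m] w _; rewrite card_iPeak.
have [_ + _ _] := nchain_peaks (descent_word w).
by rewrite size_map size_iota /=; lia.
Qed.

Lemma p_E n j (w : 'S_n) : p_ n j w = (#|Peak w| == j)%:R.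
Proof.
rewrite sum_ffunE; case: eqP => h.
  rewrite (bigD1 w) ?h //= ffunE eqxx big1 ?addr0 // => u /andP[_ nuw].
  by rewrite ffunE eq_sym (negPf nuw).
rewrite big1 // => u /eqP hu; rewrite ffunE; case: eqP => // E; by case: h; rewrite E.
Qed.

Lemma pc_E n j (w : 'S_n) : pc_ n j w = (#|iPeak w| == j.-1)%:R.
Proof.
rewrite sum_ffunE; case: eqP => h.
  rewrite (bigD1 w) ?h //= ffunE eqxx big1 ?addr0 // => u /andP[_ nuw].
  by rewrite ffunE eq_sym (negPf nuw).
rewrite big1 // => u /eqP hu; rewrite ffunE; case: eqP => // E; by case: h; rewrite E.
Qed.

Lemma shuffle_oddE m k (w : 'S_m.+1) :
  shuffle m.+1 k.*2.+1 w = binom_sum (peak_poly m.+1 #|Peak w|) k.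
Proof.
have [_ _ + _] := nchain_peaks (descent_word w).
by rewrite shuffleE card_Peak => ->; rewrite size_map size_iota.
Qed.

Lemma shuffle_evenE m k (w : 'S_m.+1) :
  shuffle m.+1 k.*2 w = binom_sum (ipeak_poly m.+1 #|iPeak w|) k.
Proof.
have [_ _ _ +] := nchain_peaks (descent_word w).
by rewrite shuffleE card_iPeak => ->; rewrite size_map size_iota.
Qed.

Lemma shuffle_odd n k : (0 < n)%N ->
  shuffle n k.*2.+1 = \sum_(j < (n./2).+1) binom_sum (peak_poly n j) k *: p_ n j.
Proof.
case: n => // m _; apply/ffunP => w; rewrite shuffle_oddE sum_ffunE.
have hw : (#|Peak w| < (m.+1)./2.+1)%N by rewrite ltnS Peak_bound.
rewrite (bigD1 (Ordinal hw)) //= scaleQSE p_E eqxx mulr1 big1 ?addr0 // => j nj.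
rewrite scaleQSE p_E; case: eqP => [E|_]; last by rewrite mulr0.
by case/eqP: nj; apply: val_inj.
Qed.

Lemma shuffle_even n k : (0 < n)%N ->
  shuffle n k.*2 = \sum_(j < (n.+1)./2) binom_sum (ipeak_poly n j) k *: pc_ n j.+1.
Proof.
case: n => // m _; apply/ffunP => w; rewrite shuffle_evenE sum_ffunE.
have hw := @iPeak_bound m.+1 w isT.
rewrite (bigD1 (Ordinal hw)) //= scaleQSE pc_E eqxx mulr1 big1 ?addr0 // => j nj.
rewrite scaleQSE pc_E; case: eqP => [/= E|_]; last by rewrite mulr0.
by case/eqP: nj; apply: val_inj.
Qed.

(** Divisibility by X^j makes the matrix from the [p_ n j] to the odd shuffles triangular; its
    diagonal entries are 4^j. *)
Lemma peak_poly_small n j k : (k < j)%N -> binom_sum (peak_poly n j) k = 0.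
Proof.
move=> hk; rewrite /peak_poly -mulrnAr exprMn mulrCA; exact: binom_sum_small.
Qed.

Lemma peak_poly_diag n j : binom_sum (peak_poly n j) j != 0.
Proof.
rewrite /peak_poly -mulrnAr exprMn mulrCA binom_sum_diag.
by rewrite !(hornerE, hornerMn, horner_exp) /= expr1n mul1r expf_neq0.
Qed.

(** The extra factor 2X moves the diagonal of the even case to k = j + 1. *)
Lemma ipeak_poly_small n j k : (k <= j)%N -> binom_sum (ipeak_poly n j) k = 0.
Proof.
move=> hk; rewrite (_ : ipeak_poly n j = 'X^(j.+1) *
  (('X *+ 2 + 1) ^+ (n.-1 - j.*2) * ((1 + 'X) *+ 4) ^+ j *+ 2)); first exact: binom_sum_small.
by rewrite /ipeak_poly -mulrnAr exprMn exprS; ring.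
Qed.

Lemma ipeak_poly_diag n j : binom_sum (ipeak_poly n j) j.+1 != 0.
Proof.
rewrite (_ : ipeak_poly n j = 'X^(j.+1) *
  (('X *+ 2 + 1) ^+ (n.-1 - j.*2) * ((1 + 'X) *+ 4) ^+ j *+ 2)); last first.
  by rewrite /ipeak_poly -mulrnAr exprMn exprS; ring.
rewrite binom_sum_diag hornerMn mulrn_eq0 /= !(hornerE, hornerMn, horner_exp) /=.
by rewrite expr1n mul1r expf_neq0.
Qed.

(** * Polynomial dependence on the number of packets, and Vandermonde inversion *)

Lemma bin_poly m : exists P : {poly rat}, forall k : nat, P.[k%:R] = 'C(k, m)%:R.
Proof.
elim: m => [|m [P hP]]; first by exists 1 => k; rewrite hornerC bin0.
exists ((m.+1%:R)^-1 *: ('X - m%:R%:P) * P) => k.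
rewrite hornerM hornerZ !hornerE hP.
have h : m.+1%:R != 0 :> rat by rewrite pnatr_eq0.
apply: (mulfI h); rewrite -natrM mul_bin_left natrM !mulrA mulfV // mul1r.
(* For k < m the truncated k - m is harmless, because C(k,m) vanishes. *)
case: (leqP m k) => hk; first by rewrite natrB.
by rewrite bin_small // !mulr0.
Qed.

Lemma binom_sum_poly q : exists P : {poly rat}, forall k : nat, P.[k%:R] = binom_sum q k.
Proof.
have [P hP] := fin_all_exists (fun m : 'I_(size q) => bin_poly m).
exists (\sum_(m < size q) q`_m *: P m) => k; rewrite horner_sum.
under eq_bigr do rewrite hornerZ hP.
rewrite (@binom_sum_widen q k (maxn k.+1 (size q))) ?leq_maxl //.
rewrite (big_ord_widen (maxn k.+1 (size q)) (fun m => q`_m * 'C(k, m)%:R)) ?leq_maxr //.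
rewrite big_mkcond; apply: eq_bigr => m _; case: ltnP => // h.
by rewrite nth_default ?mul0r.
Qed.

Lemma shuffle_poly n : (0 < n)%N -> exists N (e : bool -> nat -> QS n),
  forall a, shuffle n a = \sum_(j < N) (a%:R ^+ j) *: e (odd a) j.
Proof.
case: n => // m _.
have H (bw : bool * 'S_m.+1) : exists P : {poly rat},
    forall a, odd a = bw.1 -> P.[a%:R] = shuffle m.+1 a bw.2.
  case: bw => [[] w] /=.
    have [P hP] := binom_sum_poly (peak_poly m.+1 #|Peak w|).
    (* A polynomial in k becomes one in a = 2k + 1. *)
    exists (P \Po (2^-1 *: ('X - 1))) => a ha.
    rewrite -[a]odd_double_half ha add1n shuffle_oddE -hP horner_comp; congr _.[_].
    have -> : (a./2.*2.+1)%:R = a./2%:R * 2 + 1 :> rat by rewrite -addn1 natrD -muln2 natrM.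
    by rewrite hornerZ !hornerE; field.
  have [P hP] := binom_sum_poly (ipeak_poly m.+1 #|iPeak w|).
  exists (P \Po (2^-1 *: 'X)) => a ha.
  rewrite -[a]odd_double_half ha add0n shuffle_evenE -hP horner_comp; congr _.[_].
  have -> : (a./2.*2)%:R = a./2%:R * 2 :> rat by rewrite -muln2 natrM.
  by rewrite hornerZ hornerX; field.
have [P hP] := fin_all_exists H.
exists (\max_bw size (P bw)), (fun b j => [ffun w => (P (b, w))`_j]) => a.
apply/ffunP => w; rewrite sum_ffunE -(hP (odd a, w)) // (@horner_coef_wide _ (\max_bw size (P bw))).
  by apply: eq_bigr => j _; rewrite scaleQSE ffunE mulrC.
exact: leq_bigmax.
Qed.

(** The weights [c j] read off the coefficient of X^j of a polynomial of degree below N from its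
    values at the nodes. *)
Lemma vandermonde_dual N (x : 'I_N -> rat) : injective x ->
  exists c : 'I_N -> 'I_N -> rat, forall i j : 'I_N, \sum_k c j k * x k ^+ i = (i == j)%:R.
Proof.
move=> injx; pose V := Vandermonde N (\row_k x k).
have uV : V \in unitmx.
  rewrite unitmxE det_Vandermonde unitfE; apply/prodf_neq0 => i _.
  apply/prodf_neq0 => j hij; rewrite !mxE subr_eq0 (inj_eq injx).
  by apply: contraTneq hij => ->; rewrite ltnn.
exists (fun j k => invmx V k j) => i j; have := mulmxV uV.
move/matrixP/(_ i j); rewrite !mxE => <-; apply: eq_bigr => k _.
by rewrite !mxE mulrC.
Qed.

(** * Algebras spanned by orthogonal idempotents *)

Lemma memv_sum_lines n (I : finType) (f : I -> QS n) (x : QS n) :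
  x \in (\sum_i <[f i]>)%VS -> exists c : I -> rat, x = \sum_i c i *: f i.
Proof.
case/memv_sumP => v hv ->.
have h i : exists c : rat, v i = c *: f i by have /vlineP[c ->] := hv i isT; exists c.
have [c hc] := fin_all_exists h.
by exists c; apply: eq_bigr => i _.
Qed.

Lemma mem_line_sum n (I : finType) (f : I -> QS n) i : f i \in (\sum_i <[f i]>)%VS.
Proof. by apply: (subvP (sumv_sup i _ (subvv _))); rewrite ?memv_line. Qed.

Lemma gmul_lincomb n (I J : finType) (f : I -> QS n) (g : J -> QS n) (a : I -> rat) (b : J -> rat) :
  gmul (\sum_i a i *: f i) (\sum_j b j *: g j) =
  \sum_i \sum_j (a i * b j) *: gmul (f i) (g j).
Proof.
rewrite gmul_suml; apply: eq_bigr => i _; rewrite gmul_sumr scaler_sumr.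
by apply: eq_bigr => j _; rewrite scalerA.
Qed.

Lemma gmul_mem n (I J : finType) (f : I -> QS n) (g : J -> QS n) (A B V : {vspace QS n}) :
  (A <= \sum_i <[f i]>)%VS -> (B <= \sum_j <[g j]>)%VS ->
  (forall i j, gmul (f i) (g j) \in V) ->
  forall a b, a \in A -> b \in B -> gmul a b \in V.
Proof.
move=> /subvP sA /subvP sB h a b /sA/memv_sum_lines [c ->] /sB/memv_sum_lines [d ->].
rewrite gmul_lincomb; apply: memv_suml => i _; apply: memv_suml => j _.
by rewrite memvZ ?h.
Qed.

(* On a span of orthogonal idempotents the product is coordinatewise, so a nilpotent
   element has nilpotent, hence zero, coordinates. *)
Lemma orthogonal_idempotents n (V : {vspace QS n}) (I : finType) (f : I -> QS n) :
  gone n \in V -> (forall i, f i \in V) -> (V <= \sum_i <[f i]>)%VS ->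
  (forall i j, gmul (f i) (f j) = (i == j)%:R *: f j) ->
  is_comm V /\ is_semisimple V.
Proof.
move=> V1 Vf sV orth.
have mulf a b : gmul (\sum_i a i *: f i) (\sum_i b i *: f i) = \sum_i (a i * b i) *: f i.
  rewrite gmul_lincomb; apply: eq_bigr => i _; rewrite (bigD1 i) //= orth eqxx scale1r.
  by rewrite big1 ?addr0 // => j nji; rewrite orth eq_sym (negPf nji) scale0r scaler0.
have coordV x : x \in V -> exists c : I -> rat, x = \sum_i c i *: f i.
  by move/(subvP sV)/memv_sum_lines.
have mulV : forall a b, a \in V -> b \in V -> gmul a b \in V.
  by apply: (gmul_mem sV sV) => i j; rewrite orth memvZ.
have fi a i : gmul (f i) (\sum_j a j *: f j) = a i *: f i.
  rewrite gmul_sumr (bigD1 i) //= orth eqxx scale1r big1 ?addr0 // => j nji.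
  by rewrite orth eq_sym (negPf nji) scale0r scaler0.
have oneE : gone n = \sum_i f i.
  have [u hu] := coordV _ V1; rewrite hu; apply: eq_bigr => i _.
  by rewrite -fi -hu gmul1.
split.
  move=> a b /coordV[c ->] /coordV[d ->]; rewrite !mulf.
  by apply: eq_bigr => i _; rewrite mulrC.
split=> // J [/subvP sJ _] [k [k0 nilJ]]; apply/eqP; rewrite -subv0; apply/subvP => x Jx.
have [c hc] := coordV _ (sJ _ Jx).
have powx m : gprod (nseq m x) = \sum_i c i ^+ m *: f i.
  elim: m => [|m IH] /=; first by rewrite /gprod /= oneE; apply: eq_bigr => i _; rewrite expr0 scale1r.
  rewrite /gprod /= -/(gprod _) IH {1}hc mulf.
  by apply: eq_bigr => i _; rewrite exprS.
have := nilJ (nseq k x); rewrite size_nseq all_nseq Jx orbT powx => /(_ erefl isT) x0.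
rewrite memv0 hc big1 // => i _; apply/eqP.
(* Some [f i] may be zero, so the conclusion is that the term [c i *: f i] vanishes. *)
have := congr1 (gmul (f i)) x0; rewrite fi linear0 => /eqP.
by rewrite !scaler_eq0 expf_eq0 k0.
Qed.

(** Powers of 3 are distinct and odd: multiplying by them varies the node but keeps the parity
    class. The membership clause asks only for the shuffles used in the extraction, which are those
    that a generated subalgebra or ideal supplies. *)
Lemma shuffle_idempotents n : (0 < n)%N -> exists N (e : bool -> 'I_N -> QS n),
  [/\ forall a, shuffle n a = \sum_(j < N) (a%:R ^+ j) *: e (odd a) j,
      forall b (W : {vspace QS n}), (forall k, shuffle n ((if b then 1 else 2) * 3 ^ k) \in W) ->
        forall j, e b j \in W &
      forall b b' i j, gmul (e b i) (e b' j) = (i == j)%:R *: e (b && b') j].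
Proof.
move=> n0; have [N [e0 he]] := shuffle_poly n0.
pose e b (j : 'I_N) := e0 b j.
have inj3 : injective (fun k : 'I_N => (3 ^ k)%:R : rat).
  by move=> i j /eqP; rewrite eqr_nat eqn_exp2l // => /eqP/val_inj.
have [c hc] := vandermonde_dual inj3.
pose r (b : bool) : nat := if b then 1%N else 2%N.
have L s j : \sum_k c j k *: shuffle n (s * 3 ^ k) = s%:R ^+ j *: e (odd s) j.
  under eq_bigr => k _.
    rewrite he oddM oddX orbT andbT scaler_sumr.
    under eq_bigr => i _ do rewrite natrM exprMn scalerA mulrCA.
    over.
  rewrite exchange_big /= (bigD1 j) //= -scaler_suml -mulr_sumr hc eqxx mulr1.
  rewrite [X in _ + X]big1 ?addr0 // => i nij.
  by rewrite -scaler_suml -mulr_sumr hc (negPf nij) mulr0 scale0r.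
have rn0 b (j : 'I_N) : (r b)%:R ^+ j != 0 :> rat by rewrite expf_neq0 // pnatr_eq0; case: b.
have eE b j : e b j = ((r b)%:R ^+ j)^-1 *: \sum_k c j k *: shuffle n (r b * 3 ^ k).
  by rewrite L scalerA mulVf // scale1r; case: b.
(* [shuffle n s] scales [e b j] by s^j, up to parity: the extraction defining [e b j] now runs over
   multiples of s. *)
have me s b j : gmul (shuffle n s) (e b j) = s%:R ^+ j *: e (odd s && b) j.
  rewrite {1}eE linearZ /= gmul_sumr.
  under eq_bigr do rewrite shuffleM mulnA.
  rewrite L scalerA natrM exprMn oddM mulrC mulfK //.
  by rewrite (_ : odd (r b) = b) //; case: b.
exists N, e; split.
- by move=> a; rewrite he.
- move=> b W hW j; rewrite eE memvZ //; apply: memv_suml => k _; exact: memvZ.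
move=> b b' i j; rewrite (eE b) -/(gmulr _ _) linearZ /= /gmulr gmul_suml.
under eq_bigr do rewrite me natrM exprMn oddM oddX orbT andbT scalerA mulrCA.
rewrite -scaler_suml -mulr_sumr hc scalerA eq_sym.
rewrite (_ : odd (r b) = b); last by case: b.
case: eqP => [->|_]; last by rewrite !mulr0.
by rewrite mulr1 mulVf.
Qed.

(** * Spans of odd and of even shuffles *)

Lemma p_mem n j : p_ n j \in wp n.
Proof.
case: (ltnP j (n./2).+1) => h; first by apply/memv_span/map_f; rewrite mem_iota.
suff -> : p_ n j = 0 by rewrite mem0v.
apply: big1 => u /eqP hu; have := Peak_bound u; lia.
Qed.

Lemma shuffle_odd_mem n k : (0 < n)%N -> shuffle n k.*2.+1 \in wp n.
Proof. by move=> n0; rewrite shuffle_odd //; apply: memv_suml => j _; rewrite memvZ ?p_mem. Qed.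

Lemma shuffle_even_mem n k : (0 < n)%N -> shuffle n k.*2 \in wpc n.
Proof.
move=> n0; rewrite shuffle_even //; apply: memv_suml => j _; rewrite memvZ //.
by apply/memv_span/map_f; rewrite mem_iota; have := ltn_ord j; lia.
Qed.

(** Forward substitution: row j expresses [v j] through an element of [W] and earlier vectors. *)
Lemma triangular_mem n m (c : nat -> nat -> rat) (v : nat -> QS n) (W : {vspace QS n}) :
  (forall j k, (k < j)%N -> c j k = 0) -> (forall j, c j j != 0) ->
  (forall k, \sum_(j < m) c j k *: v j \in W) ->
  forall j, (j < m)%N -> v j \in W.
Proof.
move=> c0 cn0 hW; elim/ltn_ind => j IH hj.
have := hW j; rewrite (bigD1 (Ordinal hj)) //= rpredDr ?memvZ_eq //.
  by move=> h; rewrite -(scale1r (v j)) -(mulVf (cn0 j)) -scalerA memvZ.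
apply: memv_suml => i nij; case: (ltngtP i j) => [h|h|h].
- by rewrite memvZ // IH.
- by rewrite c0 // scale0r mem0v.
- by case/eqP: nij; apply: val_inj.
Qed.

Lemma wp_sub n (W : {vspace QS n}) : (0 < n)%N ->
  (forall k, shuffle n k.*2.+1 \in W) -> (wp n <= W)%VS.
Proof.
move=> n0 hW; apply/span_subvP => _ /mapP[j + ->]; rewrite mem_iota => /andP[_ hj].
apply: (@triangular_mem _ (n./2).+1 (fun j k => binom_sum (peak_poly n j) k) (p_ n)) => //.
- by move=> i k; apply: peak_poly_small.
- by move=> i; apply: peak_poly_diag.
- by move=> k; rewrite -shuffle_odd.
Qed.

Lemma wpc_sub n (W : {vspace QS n}) : (0 < n)%N ->
  (forall k, shuffle n k.*2 \in W) -> (wpc n <= W)%VS.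
Proof.
move=> n0 hW; apply/span_subvP => _ /mapP[[|j] + ->]; rewrite mem_iota // => /andP[_ hj].
apply: (@triangular_mem _ (n.+1)./2 (fun j k => binom_sum (ipeak_poly n j) k.+1)
          (fun j => pc_ n j.+1)) => //.
- by move=> i k hk; apply: ipeak_poly_small.
- by move=> i; apply: ipeak_poly_diag.
- by move=> k; rewrite -shuffle_even.
Qed.

Lemma gone_mem n : (0 < n)%N -> gone n \in wp n.
Proof. by move=> n0; rewrite -shuffle1; apply: (@shuffle_odd_mem n 0). Qed.

(** By triangularity the unit is a nonzero multiple of [p_ n 0], and [shuffle n 3] involves only
    [p_ n 0] and [p_ n 1]; its powers are the remaining shuffles. *)
Lemma shuffle_pow3_mem n (W : {vspace QS n}) : (0 < n)%N ->
  is_subalg W -> p_ n 1 \in W -> forall k, shuffle n (3 ^ k) \in W.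
Proof.
move=> n0 [W1 WM] Wp.
have Wp0 : p_ n 0 \in W.
  have := W1; rewrite -shuffle1 (@shuffle_odd n 0) // big_ord_recl big1 ?addr0 => [h|i _].
    by rewrite -(scale1r (p_ n 0)) -(mulVf (peak_poly_diag n 0)) -scalerA memvZ.
  by rewrite peak_poly_small ?scale0r.
have W3 : shuffle n 3 \in W.
  rewrite (@shuffle_odd n 1) //; apply: memv_suml => -[[|[|j]] hj] _ /=; [exact: memvZ|exact: memvZ|].
  by rewrite peak_poly_small // scale0r mem0v.
elim=> [|k IH]; first by rewrite expn0 shuffle1.
by rewrite expnS -shuffleM WM.
Qed.

Lemma shuffle2_mem n (W : {vspace QS n}) : (0 < n)%N -> pc_ n 1 \in W -> shuffle n 2 \in W.
Proof.
move=> n0 h; rewrite (@shuffle_even n 1) //; apply: memv_suml => -[[|j] hj] _ /=.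
  by rewrite memvZ.
by rewrite ipeak_poly_small // scale0r mem0v.
Qed.

(** * Containment in the peak algebra *)

(** Adjacent positions cannot both be peaks, so grouping by peak set gives sums of [P_F]. Interior
    peaks are covered too, being the peaks other than 1. *)
Lemma mem_peak_alg n (Q : pred {set 'I_n}) :
  \sum_(u : 'S_n | Q (Peak u)) delta u \in peak_alg n.
Proof.
have Fn (u : 'S_n) : in_Fn (Peak u).
  apply/andP; split; first by apply/'forall_implyP => i; rewrite inE => /andP[].
  apply/'forall_implyP => i; rewrite inE => /and4P[_ _ _ h1].
  apply/'forall_implyP => j; rewrite inE => /and4P[_ _ h2 _].
  by apply: contraTneq h1 => h; move: h2; rewrite -h -leqNgt; apply: ltnW.
rewrite (partition_big (@Peak n) (fun F => in_Fn F && Q F)) /= => [|u ->]; last by rewrite Fn.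
apply: memv_suml => F /andP[hF QF].
rewrite (eq_bigl (fun u => Peak u == F)) => [|u]; last by case: eqP => [->|]; rewrite ?andbT ?andbF.
by apply/memv_span/map_f; rewrite mem_enum.
Qed.

Lemma wph_peak_alg n : (wph n <= peak_alg n)%VS.
Proof.
rewrite subv_add; apply/andP; split; apply/span_subvP => _ /mapP[j _ ->].
  exact: (@mem_peak_alg n (fun F => #|F| == j)).
rewrite /pc_ (eq_bigl (fun u => #|[set i in Peak u | (1 < i)%N]| == j.-1)).
  exact: (@mem_peak_alg n (fun F => #|[set i in F | (1 < i)%N]| == j.-1)).
by move=> u; congr (_ == _); apply: eq_card => i; rewrite !inE andbC.
Qed.

(** * Permutations with prescribed numbers of peaks and interior peaks *)

(** The j isolated positions b, b+2, ..., b+2(j-1). For [b = false] and j > 0 the first step is a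
    descent and gives a peak that is not interior. *)
Definition zigzag (b : bool) (j i : nat) : bool := ((odd i == b) && (i < j.*2 + b))%N.

Lemma zigzag_sparse b j i : ~~ (zigzag b j i && zigzag b j i.+1).
Proof. by rewrite /zigzag /=; case: b; case: odd; rewrite ?andbF. Qed.

Lemma zigzag_bound b j i : zigzag b j i -> (i.+1 < j.*2 + b)%N.
Proof. by rewrite /zigzag => /andP[/eqP hi]; case: b hi => /=; lia. Qed.

Lemma peaks_sparse (D : nat -> bool) c k m :
  (forall i, ~~ (D i && D i.+1)) -> ~~ (c && D k) ->
  peaks c [seq D i | i <- iota k m] = count D (iota k m).
Proof.
move=> hD; elim: m c k => //= m IH c k hc; rewrite IH //.
by case: c hc => //= /negPf ->.
Qed.

Lemma count_zigzag b j m : count (zigzag b j) (iota 0 m) = minn j ((m + ~~ b)./2).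
Proof.
elim: m => [|m IH]; first by case: b; rewrite /= ?minn0.
rewrite -[m.+1]addn1 iotaD count_cat IH add0n /= addn0 /zigzag.
by case: b {IH} => /=; case E: (odd m) => /=; lia.
Qed.

(* Reversing the pairs of positions b+2i, b+2i+1 (i < j, counted from 0) of the identity. *)
Lemma zigzag_perm m (b : bool) j : (j.*2 + b <= m.+1)%N ->
  exists w : 'S_m.+1, descent_word w = [seq zigzag b j i | i <- iota 0 m].
Proof.
move=> hj.
pose s i := (if zigzag b j i then i.+1 else if (0 < i) && zigzag b j i.-1 then i.-1 else i)%N.
have D0 i : zigzag b j i -> zigzag b j i.+1 = false.
  by move=> h; have := zigzag_sparse b j i; rewrite h => /negPf.
have sK : involutive s.
  move=> i; rewrite /s; case h: (zigzag b j i); first by rewrite (D0 _ h) /= h.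
  by case: i h => [|i] h /=; rewrite ?h //; case h': (zigzag b j i); rewrite ?h' ?h.
have sm i : (i <= m)%N -> (s i <= m)%N.
  by rewrite /s; case: ifP => [/zigzag_bound|_]; [lia | case: ifP => _; lia].
have inj : injective (fun i : 'I_m.+1 => inord (s i) : 'I_m.+1).
  move=> i k /(congr1 val); rewrite /= !inordK; first by move/(can_inj sK)/val_inj.
    by apply: sm; rewrite -ltnS.
  by apply: sm; rewrite -ltnS.
exists (perm inj); apply/eq_in_map => i; rewrite mem_iota add0n => /andP[_ hi].
have pE k : (k <= m)%N -> perm inj (inord k) = s k :> nat.
  by move=> hk; rewrite permE [nat_of_ord (inord k)]inordK // inordK // ltnS sm.
rewrite /descent !pE //; last exact: ltnW.
rewrite /s /=; case h: (zigzag b j i); first by rewrite (D0 _ h) ltnSn.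
by case: ifP => _; case: ifP => _; lia.
Qed.

Lemma zigzag_left n j : (0 < n)%N -> (j <= n./2)%N ->
  exists w : 'S_n, #|Peak w| = j /\ #|iPeak w| = j.-1.
Proof.
case: n => // m _ hj; have h : (j.*2 + false <= m.+1)%N by lia.
have [w hw] := zigzag_perm h; exists w; rewrite card_Peak card_iPeak hw.
split; first by rewrite peaks_sparse ?count_zigzag //=; [lia | exact: zigzag_sparse].
case: m hj h w hw => [|m] hj h w hw; first by rewrite /=; lia.
(* Barring a peak in the first position loses only the descent at step 0. *)
have := count_zigzag false j m.+1; rewrite /= add0n peaks_sparse.
- by rewrite /zigzag /=; lia.
- exact: zigzag_sparse.
- exact: (zigzag_sparse false j 0).
Qed.

Lemma zigzag_inner n j : (j < n.+1./2)%N ->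
  exists w : 'S_n, #|Peak w| = j /\ #|iPeak w| = j.
Proof.
case: n => // m hj; have h : (j.*2 + true <= m.+1)%N by lia.
have [w hw] := zigzag_perm h; exists w; rewrite card_Peak card_iPeak hw.
by split; (rewrite peaks_sparse ?count_zigzag //=; [lia | exact: zigzag_sparse]).
Qed.

(** * Dimensions of the three spaces *)

(** Evaluating a linear relation at some [w] with [phi w = j] isolates its coefficient j, so the
    family is free. *)
Lemma dim_indicator n m (v : nat -> QS n) (phi : 'S_n -> nat) :
  (forall j w, v j w = (phi w == j)%:R) ->
  (forall j, (j < m)%N -> exists w, phi w = j) ->
  \dim <<[seq v j | j <- iota 0 m]>>%VS = m.
Proof.
move=> hv hphi.
have -> : [seq v j | j <- iota 0 m] = [tuple v i | i < m] :> seq _.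
  by rewrite -val_enum_ord -map_comp.
set X := [tuple _ | _ < _]; suff /eqP -> : free X by rewrite size_tuple.
apply/freeP => k + i; under eq_bigr do rewrite -tnth_nth tnth_mktuple.
have [w hw] := hphi i (ltn_ord i) => /ffunP/(_ w).
rewrite sum_ffunE (bigD1 i) //= big1 => [|j nji].
  by rewrite scaleQSE hv hw eqxx mulr1 addr0 ffunE.
rewrite scaleQSE hv hw; case: eqP => [E|_]; last by rewrite mulr0.
by case/eqP: nji; apply: val_inj.
Qed.

Lemma span_fiber n (s : seq nat) (v : nat -> QS n) (phi : 'S_n -> nat) (w w' : 'S_n) x :
  (forall j w, v j w = (phi w == j)%:R) -> x \in <<[seq v j | j <- s]>>%VS ->
  phi w = phi w' -> x w = x w'.
Proof.
move=> hv hx hw; rewrite (coord_span (X := in_tuple _) hx) !sum_ffunE.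
apply: eq_bigr => i _; rewrite !scaleQSE (nth_map 0%N) ?hv ?hw //.
by have := ltn_ord i; rewrite [X in (_ < X)%N -> _]size_map.
Qed.

Lemma dim_wp n : (0 < n)%N -> \dim (wp n) = (n./2).+1.
Proof.
move=> n0; apply: (dim_indicator (@p_E n)) => j hj.
by have [w [hw _]] := zigzag_left n0 hj; exists w.
Qed.

Lemma wpcE n : wpc n = <<[seq pc_ n j.+1 | j <- iota 0 n.+1./2]>>%VS.
Proof. by rewrite /wpc (iotaDl 1 0) -map_comp. Qed.

Lemma dim_wpc n : \dim (wpc n) = (n.+1)./2.
Proof.
rewrite wpcE; apply: (dim_indicator (phi := fun w => #|iPeak w|)) => [j w|j hj]; first exact: pc_E.
by have [w [_ hw]] := zigzag_inner hj; exists w.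
Qed.

(* An element of both spaces depends only on the number of peaks and only on the number of
   interior peaks; the permutations above connect all values of these two numbers. *)
Lemma wp_cap_wpc n : (0 < n)%N -> (wp n :&: wpc n)%VS = <[ [ffun=> 1] : QS n ]>%VS.
Proof.
move=> n0; apply/eqP; rewrite eqEsubv; apply/andP; split; last first.
  rewrite -memvE memv_cap; apply/andP; split.
    rewrite (_ : [ffun=> 1] = \sum_(j < (n./2).+1) p_ n j).
      by apply: memv_suml => j _; exact: p_mem.
    apply/ffunP => w; rewrite ffunE sum_ffunE.
    have hw : (#|Peak w| < (n./2).+1)%N by rewrite ltnS Peak_bound.
    rewrite (bigD1 (Ordinal hw)) //= p_E eqxx big1 ?addr0 // => j nj.
    by rewrite p_E; case: eqP => // E; case/eqP: nj; apply: val_inj.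
  rewrite (_ : [ffun=> 1] = \sum_(j < (n.+1)./2) pc_ n j.+1).
    by apply: memv_suml => j _; rewrite wpcE; apply/memv_span/map_f; rewrite mem_iota ltn_ord.
  apply/ffunP => w; rewrite ffunE sum_ffunE.
  have hw := @iPeak_bound n w n0.
  rewrite (bigD1 (Ordinal hw)) //= pc_E eqxx big1 ?addr0 // => j nj.
  by rewrite pc_E; case: eqP => // E; case/eqP: nj; apply: val_inj.
apply/subvP => x; rewrite memv_cap wpcE => /andP[hx hx'].
have fP w w' : #|Peak w| = #|Peak w'| -> x w = x w' by apply: (span_fiber (@p_E n) hx).
have fI w w' : #|iPeak w| = #|iPeak w'| -> x w = x w'.
  by apply: (span_fiber (phi := fun w => #|iPeak w|) _ hx') => j u; exact: pc_E.
have [w0 [h0 _]] := zigzag_left n0 (leq0n _).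
have xw j w : #|Peak w| = j -> x w = x w0.
  elim: j w => [|j IH] w hw; first by apply: fP; rewrite hw h0.
  have hj : (j.+1 <= n./2)%N by rewrite -hw Peak_bound.
  have [u [u1 u2]] := zigzag_left n0 hj.
  have [|v [v1 v2]] := @zigzag_inner n j; first by lia.
  by rewrite (fP w u) ?hw ?u1 // (fI u v) ?u2 ?v2 //; apply: IH.
apply/vlineP; exists (x w0); apply/ffunP => w.
by rewrite scaleQSE ffunE mulr1; apply: xw.
Qed.

Lemma dim_wph n : (0 < n)%N -> \dim (wph n) = n.
Proof.
move=> n0; have := dimv_sum_cap (wp n) (wpc n).
rewrite dim_wp // dim_wpc wp_cap_wpc // dim_vline.
have -> : ([ffun=> 1] : QS n) != 0.
  by apply/eqP => /ffunP/(_ 1%g); rewrite !ffunE => /eqP; rewrite oner_eq0.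
by rewrite /wph /=; lia.
Qed.

Theorem theorem6p8 (n : nat) (hn : (0 < n)%N) :
  (* hat wp_n is a commutative semisimple (unital) subalgebra of P_n *)
  ((wph n <= peak_alg n)%VS /\ is_subalg (wph n) /\ is_comm (wph n)
     /\ is_semisimple (wph n)) /\
  (* (a) *)
  subalg_generated_by (wph n) [:: p_ n 1; pc_ n 1] /\
  (* (b) *)
  ((wp n <= wph n)%VS /\ subalg_generated_by (wp n) [:: p_ n 1]
     /\ is_semisimple (wp n)) /\
  (* (c) *)
  ideal_generated_by (wph n) (wpc n) (pc_ n 1) /\
  (* (d) *)
  (\dim (wph n) = n /\ \dim (wp n) = (n./2).+1 /\ \dim (wpc n) = (n.+1)./2).
Proof.
have [N [e [shE e_mem e_mul]]] := shuffle_idempotents hn.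
have odd_sub (W : {vspace QS n}) : (forall j, e true j \in W) -> (wp n <= W)%VS.
  move=> h; apply: wp_sub => // k; rewrite shE; apply: memv_suml => j _.
  by rewrite memvZ //= odd_double.
have even_sub (W : {vspace QS n}) : (forall j, e false j \in W) -> (wpc n <= W)%VS.
  move=> h; apply: wpc_sub => // k; rewrite shE; apply: memv_suml => j _.
  by rewrite memvZ //= odd_double.
have e_wp j : e true j \in wp n.
  apply: e_mem => k; rewrite mul1n -[(3 ^ k)%N]odd_double_half oddX orbT add1n.
  exact: shuffle_odd_mem.
have e_wpc j : e false j \in wpc n.
  by apply: e_mem => k; rewrite mul2n; apply: shuffle_even_mem.
have wp_wph : (wp n <= wph n)%VS by apply: addvSl.
have wpc_wph : (wpc n <= wph n)%VS by apply: addvSr.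
have e_wph b j : e b j \in wph n.
  by case: b; [exact: (subvP wp_wph) | exact: (subvP wpc_wph)].
have pc_wpc : pc_ n 1 \in wpc n by apply/memv_span/map_f; rewrite mem_iota; lia.
(* [e false j] lies below [e true j] as an idempotent; subtracting it makes the whole family
   orthogonal. *)
pose f (bi : bool * 'I_N) := if bi.1 then e true bi.2 - e false bi.2 else e false bi.2.
have f_wph bi : f bi \in wph n by case: bi => [[] i]; rewrite /f /= ?memvB.
have gmulBl a a' b : gmul (a - a') b = gmul a b - gmul a' b :> QS n.
  by rewrite -![gmul _ b]/(gmulr b _) linearB.
have f_mul bi bj : gmul (f bi) (f bj) = (bi == bj)%:R *: f bj.
  case: bi bj => [[] i] [[] j]; rewrite xpair_eqE /f /= ?gmulBl ?linearB /= ?gmulBl !e_mul /=.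
  - by rewrite subrr addr0.
  - by rewrite subrr scale0r.
  - by rewrite subrr !scale0r subr0.
  - by [].
have e_f b j : e b j \in (\sum_bi <[f bi]>)%VS.
  have hF := mem_line_sum f (false, j); case: b => //.
  by rewrite -(subrK (e false j) (e true j)) memvD // (mem_line_sum f (true, j)).
have wph_f : (wph n <= \sum_bi <[f bi]>)%VS by rewrite subv_add odd_sub // even_sub.
have gone_wph : gone n \in wph n by apply: (subvP wp_wph); exact: gone_mem.
have [commV semiV] := orthogonal_idempotents gone_wph f_wph wph_f f_mul.
have wp_e : (wp n <= \sum_j <[e true j]>)%VS.
  by apply: odd_sub => j; apply: mem_line_sum.
have [_ semiW] := orthogonal_idempotents (gone_mem hn) e_wp wp_e (e_mul true true).
have wpc_e : (wpc n <= \sum_j <[e false j]>)%VS.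
  by apply: even_sub => j; apply: mem_line_sum.
have gen3 (W : {vspace QS n}) : is_subalg W -> p_ n 1 \in W -> (wp n <= W)%VS.
  by move=> sW pW; apply: odd_sub; apply: e_mem => k; rewrite mul1n; apply: shuffle_pow3_mem.
have ideal_c : is_ideal (wph n) (wpc n).
  split=> // a x aV xI.
  suff ax : gmul a x \in wpc n by rewrite -(commV a x aV (subvP wpc_wph _ xI)).
  (* The differences in [f] annihilate every [e false j], so only products among the [e false i]
     survive. *)
  apply: (gmul_mem wph_f wpc_e) aV xI => [[[] i] j]; rewrite /f /= ?gmulBl !e_mul /= ?subrr ?mem0v //.
  by rewrite memvZ.
split; first by split; [exact: wph_peak_alg | split; [case: semiV|]].
split.
  split; first by case: semiV.
    move=> x; rewrite !inE => /orP[] /eqP ->; first exact: (subvP wp_wph _ (p_mem n 1)).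
    exact: (subvP wpc_wph).
  move=> W sW hW; have pW : p_ n 1 \in W by apply: hW; rewrite inE eqxx.
  have cW : pc_ n 1 \in W by apply: hW; rewrite !inE eqxx orbT.
  rewrite subv_add gen3 //; apply: even_sub; apply: e_mem => k.
  rewrite -shuffleM; case: (sW) => _; apply; first exact: shuffle2_mem.
  exact: shuffle_pow3_mem.
split.
  split=> //; split=> //; split; first by case: semiW.
    by move=> x; rewrite inE => /eqP ->; apply: p_mem.
  by move=> W sW hW; apply: gen3 => //; apply: hW; rewrite inE.
split; last by rewrite dim_wph // dim_wp // dim_wpc.
split=> // J [JV hJ] cJ; apply: even_sub; apply: e_mem => k.
(* The factor [shuffle n (3 ^ k)] need only lie in the algebra, since [J] absorbs it. *)
rewrite mulnC -shuffleM; apply: (proj1 (hJ _ _ _ _)); last exact: shuffle2_mem.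
apply: (subvP wp_wph); apply: shuffle_pow3_mem => //; [by case: semiW | exact: p_mem].
Qed.
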